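(* Let $\lambda$ be an infinite cardinal number such that $\lambda=\lambda^{\aleph_0}$. Let $X$ be a metric space of weight $\lambda$, and let $\tau$ be the topology on $X$ induced by its metric. Then there exist topologies $\tau_1$ and $\tau_2$ on the set $X$ such that $\tau$ is the supremum of $\tau_1$ and $\tau_2$ and, for each $i\in\{1,2\}$, the space $(X,\tau_i)$ is homeomorphic to a Banach space of weight $\lambda$ (with its norm topology).
   Context: The weight of a topological space is the least cardinality of a base of its topology; the weight of a metric space is the weight of the topology induced by its metric. A topology $\tau$ on $X$ is the supremum of topologies $\tau_1$ and $\tau_2$ on $X$ if it is the coarsest topology on $X$ that is finer than $\tau_i$ for each $i=1,2$. *)

(* Defs.v *)
From HB Require Import structures.
From mathcomp Require Import all_boot all_order all_algebra.
From mathcomp Require Import all_classical all_reals all_analysis.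

Set Implicit Arguments.
Unset Strict Implicit.
Unset Printing Implicit Defensive.

Local Open Scope classical_set_scope.
Local Open Scope card_scope.

(* A topology on a fixed carrier [X] is a [Topological X] structure. Two such
   structures may differ in their (irrelevant) choice component, so topologies
   are compared through their open sets only. *)
Definition opens_of (X : Type) (t : Topological X) : set (set X) :=
  @open (Topological.Pack t).

Definition finer (X : Type) (s t : Topological X) : Prop :=
  opens_of t `<=` opens_of s.

Definition is_supremum (X : Type) (t t1 t2 : Topological X) : Prop :=
  [/\ finer t t1, finer t t2
    & forall s : Topological X, finer s t1 -> finer s t2 -> finer s t].

(* A cardinal is represented by a type [L], standing for the cardinality of
   [[set: L]]. *)
Definition has_weight (T : topologicalType) (L : Type) : Prop :=
  (exists2 B : set (set T), basis B & B #= [set: L]) /\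
  (forall B : set (set T), basis B -> [set: L] #<= B).

Definition homeomorphic (S T : topologicalType) : Prop :=
  exists (f : S -> T) (g : T -> S),
    [/\ cancel f g, cancel g f, continuous f & continuous g].

(* Main.v *)
(** The Banach space E is the closed span, inside the bounded functions on the
    disjoint union of X and an index set W of size L, of the functions
    min(1, d(a, .)) on X and of the indicators of the points of W; it contains a
    copy of X, and its size and weight are L. By a diagonal argument X contains,
    for some rho > 0, a 4 rho-separated family of size L, split into two halves
    each indexed by E. For either half, the copy of X in E is deformed on the
    balls of radius rho around the chosen points d(p): the center is pushed to p,
    while the rest of the ball is lifted along two coordinates of W outside of
    the support of p. The points p whose center is pushed are chosen by
    well-founded recursion, so that every point of E is hit exactly once; this
    gives a continuous bijection f from X onto E. The bijections f1 and f2
    obtained from the two halves deform X on disjoint sets, and jointly they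
    determine the topology of X. *)

Require Import Defs.
From HB Require Import structures.
From mathcomp Require Import all_boot all_order all_algebra.
From mathcomp Require Import all_classical all_reals all_analysis.
From mathcomp Require Import ring lra.

Set Implicit Arguments.
Unset Strict Implicit.
Unset Printing Implicit Defensive.

Import Order.TTheory GRing.Theory Num.Theory.
Import numFieldNormedType.Exports.

Local Open Scope classical_set_scope.
Local Open Scope card_scope.

(** * Cardinals *)

Definition embeds (A B : Type) := exists f : A -> B, injective f.

Lemma embeds_trans A B C : embeds A B -> embeds B C -> embeds A C.
Proof. by move=> [f fi] [g gi]; exists (g \o f); exact: inj_comp. Qed.

Lemma card_leEembeds T U (A : set T) (B : set U) : A #<= B <-> embeds A B.
Proof.
split=> [/card_leP[f]|[f fi]].
  exists f => a b ab.
  by apply: (@inj _ _ _ f); rewrite ?inE//.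
apply/card_leP; have fI : {in [set: A] &, injective f} by move=> x y _ _ /fi.
have [_ /Pfun[g ->] /funPinj[h]] : exists2 g : A -> B, set_fun setT setT g & set_inj setT g.
  by exists f.
by squash h.
Qed.

Lemma card_le_setTP T U : [set: T] #<= [set: U] <-> embeds T U.
Proof.
rewrite card_leEembeds; split=> -[f fi].
  exists (fun x => val (f (SigSub (mem_set (I : [set: T] x))))).
  by move=> x y /val_inj/fi[].
exists (fun x => SigSub (mem_set (I : [set: U] (f (val x))))).
by move=> x y [/fi/val_inj].
Qed.

Lemma embeds_fun A B C : embeds B C -> embeds (A -> B) (A -> C).
Proof.
move=> [f fi]; exists (fun g x => f (g x)) => g h gh; apply/funext => x.
by apply: fi; exact: (congr1 (@^~ x) gh).
Qed.

Lemma embeds_count_fun (T : countType) A : embeds (T -> A) (nat -> option A).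
Proof.
exists (fun f n => omap f (unpickle n)) => f g fg; apply/funext => x.
by have := congr1 (@^~ (pickle x)) fg; rewrite /= pickleK => -[].
Qed.

(* Koenig's diagonal argument: if every fibre of [t] were smaller than [L], the
   sequence picking at [k] a value missed by the fibre over [k] would have no
   image under [J]. *)
Lemma konig (L T : Type) (J : (nat -> L) -> T) (t : T -> nat) : injective J ->
  exists k, exists2 d : L -> T, injective d & forall l, t (d l) = k.
Proof.
move=> Ji.
have [k Hk] : exists k, forall l, exists s, t (J s) = k /\ s k = l.
  apply: contrapT => /forallNP H.
  have /choice[s sP] k : exists l, forall s, t (J s) = k -> s k <> l.
    have /existsNP[l /forallNP Hl] := H k.
    by exists l => s ts sk; exact: (Hl s (conj ts sk)).
  exact: (sP _ s).
have /choice[S SP] := Hk; exists k; exists (fun l => J (S l)).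
  by move=> l m /Ji Slm; rewrite -(SP l).2 -(SP m).2 Slm.
by move=> l; have [] := SP l.
Qed.

(** * Closure properties of the types that embed in [L] *)

Section countable_power.
Variable L : Type.
Hypotheses (Lpow : embeds (nat -> L) L) (Linf : infinite_set [set: L]).

Lemma embeds_two : exists l0 l1 : L, l0 <> l1.
Proof.
apply: contrapT => H; apply: Linf.
have eqL (x y : L) : x = y.
  by apply: contrapT => xy; apply: H; exists x, y.
have [[x _]|no] := pselect (exists x : L, True).
  suff -> : [set: L] = [set x] by exact: finite_set1.
  by apply/seteqP; split => // y _; exact: eqL.
suff -> : [set: L] = set0 by exact: finite_set0.
by rewrite -subset0 => x _; apply: no; exists x.
Qed.

Lemma embeds_seq_fun A : embeds A L -> embeds (nat -> A) L.
Proof. by move=> /(@embeds_fun nat) AL; exact: embeds_trans Lpow. Qed.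

Lemma embeds_bool : embeds bool L.
Proof.
have [l0 [l1 l01]] := embeds_two.
exists (fun b : bool => if b then l1 else l0) => -[] []//.
by move=> /esym/l01.
Qed.

Lemma embeds_pair A B : embeds A L -> embeds B L -> embeds (A * B) L.
Proof.
move=> [f fi] [g gi]; apply: embeds_trans Lpow.
exists (fun p n => if n is 0 then f p.1 else g p.2) => -[a b] [c d] H.
have := congr1 (@^~ 0%N) H; have := congr1 (@^~ 1%N) H.
by move=> /= /gi -> /fi ->.
Qed.

Lemma embeds_sum A B : embeds A L -> embeds B L -> embeds (A + B) L.
Proof.
move=> [f fi] [g gi]; apply: (@embeds_trans _ (bool * L)); last first.
  by apply: embeds_pair; [exact: embeds_bool | exists id].
exists (fun u => match u with inl a => (true, f a) | inr b => (false, g b) end).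
by move=> [a|b] [c|d]//= [/=] => [/fi|/gi] ->.
Qed.

Lemma embeds_opt A : embeds A L -> embeds (option A) L.
Proof.
move=> AL; apply: (@embeds_trans _ (A + bool)); last first.
  by apply: embeds_sum => //; exact: embeds_bool.
exists (fun u => if u is Some a then inl a else inr true).
by move=> [a|] [b|]//= [->].
Qed.

Lemma embeds_nat : embeds nat L.
Proof.
apply: (@embeds_trans _ (nat -> bool)); last exact: embeds_seq_fun embeds_bool.
by exists (fun m n => n == m) => m n /(congr1 (@^~ m)); rewrite eqxx => /esym/eqP.
Qed.

Lemma embeds_seq A : embeds A L -> embeds (seq A) L.
Proof.
move=> AL; apply: (@embeds_trans _ (nat -> option A)); last first.
  exact/embeds_seq_fun/embeds_opt.
exists (fun s n => nth None (map Some s) n) => s r.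
elim: s r => [|a s IH] [|b r]//= H.
- by have := congr1 (@^~ 0%N) H.
- by have := congr1 (@^~ 0%N) H.
have [->] := congr1 (@^~ 0%N) H; congr cons; apply: IH; apply/funext => n.
exact: (congr1 (@^~ n.+1) H).
Qed.

(** A real number is determined by its cut in the rationals, a countable set. *)
Lemma embeds_realType (R : realType) : embeds R L.
Proof.
apply: (@embeds_trans _ (rat -> bool)); last first.
  apply: embeds_trans (@embeds_count_fun _ _) _.
  exact/embeds_seq_fun/embeds_opt/embeds_bool.
exists (fun x q => (ratr q < x)%R) => x y H; apply/eqP; rewrite eq_le; apply/andP.
suff W (a b : R) : (forall q, (ratr q < a)%R = (ratr q < b)%R) -> (a <= b)%R.
  by split; apply: W => q; rewrite (congr1 (@^~ q) H).
move=> ab; rewrite leNgt; apply/negP => /rat_in_itvoo[q].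
by rewrite in_itv/= ab => /andP[/ltW + qb]; rewrite leNgt qb.
Qed.

End countable_power.

(* Well-founded countably branching trees. They index coordinates of the Banach
   space, and [Node l s] is a coordinate outside of the range of [s]: this
   replaces a transfinite enumeration. *)
Inductive wtree (L : Type) := Leaf | Node (l : L) (s : nat -> wtree L).
Arguments Leaf {L}.

(** Reading labels along finite paths turns a tree into a function on the countable type [seq nat],
    whence the bound on the number of trees. *)
Fixpoint wtree_label L (w : wtree L) (p : seq nat) : option L :=
  match w, p with
  | Leaf, _ => None
  | Node l s, [::] => Some l
  | Node l s, n :: q => wtree_label (s n) q
  end.

Lemma wtree_label_inj L : injective (@wtree_label L).
Proof.
elim=> [|l s IH] [|l' s'] H //=.
- by have := congr1 (@^~ [::]) H.
- by have := congr1 (@^~ [::]) H.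
have [->] := congr1 (@^~ [::]) H; congr Node; apply/funext => n; apply: IH.
by apply/funext => p; exact: (congr1 (@^~ (n :: p)) H).
Qed.

Lemma embeds_wtree L : embeds (nat -> L) L -> infinite_set [set: L] ->
  embeds (wtree L) L.
Proof.
move=> Lpow Linf; apply: (@embeds_trans _ (seq nat -> option L)).
  by exists (@wtree_label L); exact: wtree_label_inj.
apply: embeds_trans (@embeds_count_fun _ _) _.
by apply/embeds_seq_fun => //; do 2 apply: embeds_opt => //; exists id.
Qed.

Local Open Scope ring_scope.

(** * Closed spans of bounded functions *)

Section closed_span.
Context {R : realType} {Y I : Type} (G : I -> Y -> R).
Implicit Types (s : seq (R * I)) (u v : Y -> R).

Definition lincomb s (y : Y) : R := \sum_(p <- s) p.1 * G p.2 y.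

(** Closure under uniform limits is built in; boundedness is a separate clause because [G] is an
    arbitrary family. *)
Definition cspan_pred : {pred Y -> R} := fun u =>
  `[< (exists M, forall y, `|u y| <= M) /\
      (forall e, 0 < e -> exists s, forall y, `|u y - lincomb s y| <= e) >].

Lemma lincomb_scale (a : R) s y :
  lincomb [seq (a * p.1, p.2) | p <- s] y = a * lincomb s y.
Proof.
by rewrite /lincomb big_map mulr_sumr; apply: eq_bigr => p _; rewrite mulrA.
Qed.

Lemma lincomb_cat s1 s2 y : lincomb (s1 ++ s2) y = lincomb s1 y + lincomb s2 y.
Proof. by rewrite /lincomb big_cat. Qed.

Lemma cspan_submod_closed : submod_closed cspan_pred.
Proof.
split.
  rewrite unfold_in; apply/asboolP; split; first by exists 0 => y; rewrite normr0.
  by move=> e e0; exists [::] => y; rewrite /lincomb big_nil subr0 normr0 ltW.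
move=> a u v; rewrite !unfold_in => /asboolP[[M uM] ua] /asboolP[[N vN] va].
apply/asboolP; split.
  exists (`|a| * M + N) => y; rewrite (le_trans (ler_normD _ _))// lerD//.
  by rewrite normrM ler_wpM2l.
(* Dividing by [|a| + 1] instead of [|a|] covers the case [a = 0]. *)
move=> e e0; have a1 : 0 < `|a| + 1 by rewrite ltr_wpDl.
have [s1 H1] := ua (e / 2 / (`|a| + 1)) (divr_gt0 (divr_gt0 e0 (ltr0Sn _ 1)) a1).
have [s2 H2] := va (e / 2) (divr_gt0 e0 (ltr0Sn _ 1)).
exists ([seq (a * p.1, p.2) | p <- s1] ++ s2) => y.
have -> : (a *: u + v) y = a * u y + v y by [].
rewrite lincomb_cat lincomb_scale opprD addrACA.
rewrite -mulrBr (splitr e) (le_trans (ler_normD _ _))// lerD//.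
rewrite normrM (@le_trans _ _ ((`|a| + 1) * `|u y - lincomb s1 y|))//.
  by rewrite ler_wpM2r// lerDl.
by rewrite mulrC -ler_pdivlMr.
Qed.

HB.instance Definition _ :=
  GRing.isSubmodClosed.Build R (Y -> R) cspan_pred cspan_submod_closed.

Record cspan := Cspan { cspan_fun :> Y -> R; _ : cspan_fun \in cspan_pred }.

HB.instance Definition _ := [isSub for cspan_fun].
HB.instance Definition _ := [Choice of cspan by <:].
HB.instance Definition _ := [SubChoice_isSubZmodule of cspan by <:].
HB.instance Definition _ := [SubZmodule_isSubLmodule of cspan by <:].

Implicit Types f g : cspan.

Lemma cspan_bounded f : exists M, forall y, `|f y| <= M.
Proof. by case: f => u /= /asboolP[]. Qed.

Lemma cspan_approx f e : 0 < e ->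
  exists s, forall y, `|f y - lincomb s y| <= e.
Proof. by case: f => u /= /asboolP[_]; exact. Qed.

(** The sup norm; adjoining 0 keeps the supremum meaningful when [Y] is empty. *)
Definition cspan_norm f : R := sup (0 |` [set `|f y| | y in [set: Y]]).

Lemma cspan_norm_has_sup f : has_sup (0 |` [set `|f y| | y in [set: Y]]).
Proof.
split; first by exists 0; left.
have [M fM] := cspan_bounded f.
by exists (Num.max 0 M) => _ [->|[y _ <-]]; rewrite le_max ?lexx ?fM ?orbT.
Qed.

Lemma cspan_norm_ub f y : `|f y| <= cspan_norm f.
Proof. by apply: (sup_upper_bound (cspan_norm_has_sup f)); right; exists y. Qed.

Lemma cspan_norm_le f c : 0 <= c -> (forall y, `|f y| <= c) -> cspan_norm f <= c.
Proof.
by move=> c0 fc; apply: ge_sup => [|_ [->|[y _ <-]]//]; exists 0; left.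
Qed.

Lemma cspan_norm_ge0 f : 0 <= cspan_norm f.
Proof. by apply: (sup_upper_bound (cspan_norm_has_sup f)); left. Qed.

Lemma cspan_normD f g : cspan_norm (f + g) <= cspan_norm f + cspan_norm g.
Proof.
apply: cspan_norm_le => [|y]; first by rewrite addr_ge0 ?cspan_norm_ge0.
by rewrite (le_trans (ler_normD _ _))// lerD ?cspan_norm_ub.
Qed.

Lemma cspan_normZ_le a f : cspan_norm (a *: f) <= `|a| * cspan_norm f.
Proof.
apply: cspan_norm_le => [|y]; first by rewrite mulr_ge0 ?cspan_norm_ge0.
by rewrite normrM ler_wpM2l ?cspan_norm_ub.
Qed.

Lemma cspan_normZ a f : cspan_norm (a *: f) = `|a| * cspan_norm f.
Proof.
have [->|a0] := eqVneq a 0.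
  rewrite normr0 mul0r; apply/eqP; rewrite eq_le cspan_norm_ge0 andbT.
  by rewrite (le_trans (cspan_normZ_le _ _))// normr0 mul0r.
apply/eqP; rewrite eq_le cspan_normZ_le/= -ler_pdivlMl ?normr_gt0//.
rewrite -[X in cspan_norm X <= _](scalerK a0) -normfV.
exact: cspan_normZ_le.
Qed.

Lemma cspan_norm0_eq0 f : cspan_norm f = 0 -> f = 0.
Proof.
move=> f0; apply: val_inj; apply/funext => y /=.
by apply/eqP; rewrite -normr_le0 -f0 cspan_norm_ub.
Qed.

HB.instance Definition _ := @Lmodule_isNormed.Build R cspan cspan_norm
  cspan_normD cspan_normZ cspan_norm0_eq0.

Lemma ler_cspan f y : `|f y| <= `|f|. Proof. exact: cspan_norm_ub. Qed.

Lemma cspan_le f c : 0 <= c -> (forall y, `|f y| <= c) -> `|f| <= c.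
Proof. exact: cspan_norm_le. Qed.

Lemma cspanD f g y : (f + g) y = f y + g y. Proof. by []. Qed.
Lemma cspanB f g y : (f - g) y = f y - g y. Proof. by []. Qed.
Lemma cspanZ a f y : (a *: f) y = a * f y. Proof. by []. Qed.

Lemma cspan_ext f g : (forall y, f y = g y) -> f = g.
Proof. by move=> fg; apply: val_inj; apply/funext. Qed.

(** A Cauchy filter converges pointwise, and uniformly because its small sets are small in the sup
    norm; a uniform limit inherits both clauses of [cspan_pred]. *)
Lemma cspan_complete (F : set_system cspan) :
  ProperFilter F -> cauchy F -> cvg F.
Proof.
move=> FF /cauchy_ballP F_cauchy.
have Fb e : 0 < e -> exists2 A, F A & forall f g, A f -> A g -> `|f - g| < e.
  move=> e0; have /F_cauchy [[A B] [/= FA FB] AB] := e0.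
  exists (A `&` B); first exact: filterI.
  by move=> f g [Af _] [_ Bg]; have := AB (f, g) (conj Af Bg); rewrite -ball_normE.
have Fy y : cvg ((fun f : cspan => f y) @ F).
  apply: cauchy_cvg; apply/cauchy_ballP => e e0.
  have [A FA Ae] := Fb _ e0.
  exists ([set f y | f in A], [set f y | f in A]) => /=.
    by split; apply: (@filterS _ F _ A) => // f Af; exists f.
  move=> [_ _] [/= [f Af <-] [g Ag <-]].
  by rewrite /ball/= -cspanB (le_lt_trans (ler_cspan _ _))// Ae.
pose u y : R := lim ((fun f : cspan => f y) @ F).
have uF e : 0 < e -> F [set f : cspan | forall y, `|u y - f y| <= e].
  move=> e0; have [A FA Ae] := Fb _ e0.
  apply: (@filterS _ F _ A) => // f Af y.
  have fyu : (fun g : cspan => `|g y - f y|) @ F --> `|u y - f y|.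
    by apply: cvg_norm; apply: cvgB; [exact: Fy | exact: cvg_cst].
  rewrite -(cvg_lim _ fyu)//; apply: limr_le; first by apply/cvg_ex; eexists; exact: fyu.
  apply: (@filterS _ F _ A) => // g Ag.
  by rewrite -cspanB (le_trans (ler_cspan _ _))// ltW// Ae.
have uP : u \in cspan_pred.
  rewrite unfold_in; apply/asboolP; split.
    have [f fu] := filter_ex (uF 1 ltr01); have [M fM] := cspan_bounded f.
    exists (1 + M) => y; rewrite -(subrK (f y) (u y)).
    by rewrite (le_trans (ler_normD _ _))// lerD.
  move=> e e0; have e20 : 0 < e / 2 by rewrite divr_gt0.
  have [f fu] := filter_ex (uF _ e20); have [s sf] := cspan_approx f e20.
  exists s => y; rewrite -(subrKA (f y) (u y)) (splitr e).
  by rewrite (le_trans (ler_normD _ _))// lerD.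
apply/cvg_ex; exists (Cspan uP); apply/cvgrPdist_le => e e0.
by apply: filterS (uF _ e0) => f uf; apply: cspan_le; [exact: ltW|move=> y; exact: uf].
Qed.

HB.instance Definition _ := Uniform_isComplete.Build cspan cspan_complete.

Lemma cspan_gen_in i : (exists M, forall y, `|G i y| <= M) -> G i \in cspan_pred.
Proof.
move=> bG; rewrite unfold_in; apply/asboolP; split => // e e0.
exists [:: (1, i)] => y.
by rewrite /lincomb big_seq1/= mul1r subrr normr0 ltW.
Qed.

End closed_span.

(** * Weight of metric spaces *)

Lemma metric_ball_open (R : realType) (X : metricType R) (x : X) (r : R) :
  open (ball x r).
Proof.
rewrite openE => y; rewrite ballEmdist /= => xy; apply/nbhs_ballP.
exists (r - mdist x y); first by rewrite /= subr_gt0.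
by move=> z; rewrite !ballEmdist/= ltrBrDl; apply: le_lt_trans; exact: metric_triangle.
Qed.

Lemma inv_nat_lt (R : realType) (e : R) : 0 < e -> exists n, n.+1%:R^-1 < e.
Proof.
move=> e0; have [n _ H] := near_infty_natSinv_lt (PosNum e0).
by exists n; apply: H => /=.
Qed.

Section metric_weight.
Context {R : realType} {L : Type} (X : metricType R).

(** A point is determined by a sequence of basic sets that contain it and shrink to it, so [X] has
    at most as many points as there are sequences in [L]. *)
Lemma metric_embeds : embeds (nat -> L) L -> has_weight X L -> embeds X L.
Proof.
move=> Lpow [[B [Bo Bb] /card_eqPle[/card_leEembeds[e ei] _]] _].
apply: embeds_trans Lpow.
have /choice[b bP] (p : X * nat) : exists U : B,
    val U p.1 /\ val U `<=` ball p.1 (p.2.+1%:R^-1 : R).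
  have [|U [BU Ux] Us] := Bb p.1 (ball p.1 (p.2.+1%:R^-1 : R)).
    by apply: nbhsx_ballx; rewrite invr_gt0.
  by exists (SigSub (mem_set BU)).
exists (fun x n => val (e (b (x, n)))) => x y H.
apply/eqP; rewrite eq_sym -[_ == _]negbK -mdist_gt0; apply/negP => /inv_nat_lt[n].
apply/negP; rewrite -leNgt.
have /val_inj/ei bxy := congr1 (@^~ n) H.
have [bx _] := bP (x, n); have [_ /(_ x)] := bP (y, n).
by rewrite -bxy => /(_ bx); rewrite ballEmdist => /ltW.
Qed.

(** Zorn's lemma gives a maximal separated set; a point at distance at least [e] from all of it
    could be adjoined. *)
Lemma maximal_separated (e : R) : 0 < e -> exists D : set X,
  (forall x y, D x -> D y -> mdist x y < e -> x = y) /\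
  (forall x, exists2 d, D d & mdist d x < e).
Proof.
move=> e0; pose P (D : set X) := forall x y, D x -> D y -> mdist x y < e -> x = y.
have [|D [PD Dmax]] := @Zorn_bigcup X P.
  move=> F FP Ftot x y [A FA Ax] [B FB By].
  have [AB|BA] := Ftot _ _ FA FB; first by apply: (FP _ FB) => //; exact: AB.
  by apply: (FP _ FA) => //; exact: BA.
exists D; split => // x; apply: contrapT => H.
have xD d : D d -> e <= mdist d x.
  by move=> Dd; rewrite leNgt; apply/negP => dx; apply: H; exists d.
apply: (Dmax (x |` D)).
  split; first by move=> z; right.
  by move=> /(_ x (or_introl erefl))/xD; rewrite mdistxx leNgt e0.
move=> y z [->|Dy] [->|Dz] //; last exact: PD.
- by rewrite metric_sym ltNge xD.
- by rewrite ltNge xD.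
Qed.

(** Balls of radius [1/(n+1)] around maximal [1/(n+1)]-separated sets form a base, so [L], and with
    it [nat -> L], injects into the pairs of a centre and a level. Koenig's argument then finds [L]
    many centres on one level, where they are separated. *)
Lemma separated_embedding : embeds (nat -> L) L -> has_weight X L ->
  exists2 r : R, 0 < r & exists d : L -> X,
    forall l m, mdist (d l) (d m) < r -> l = m.
Proof.
move=> [pow powi] [_ Xmin].
have /choice[D DP] (n : nat) : exists D : set X,
  (forall x y, D x -> D y -> mdist x y < n.+1%:R^-1 :> R -> x = y) /\
  (forall x, exists2 d, D d & mdist d x < n.+1%:R^-1 :> R).
  by apply: maximal_separated; rewrite invr_gt0.
pose B := [set U | exists2 p : X * nat, D p.2 p.1 & U = ball p.1 (p.2.+1%:R^-1 : R)].
have Bb : basis B.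
  split; first by move=> _ [p _ ->]; exact: metric_ball_open.
  move=> x A /nbhs_ballP[e /= e0 xA].
  have [n ne] := inv_nat_lt (divr_gt0 e0 (ltr0Sn R 1)).
  have [d Dd dx] := (DP n).2 x; exists (ball d (n.+1%:R^-1 : R)).
    by split; [exists (d, n) | rewrite ballEmdist].
  move=> y; rewrite ballEmdist /= => dy; apply: xA.
  rewrite ballEmdist /= (le_lt_trans (metric_triangle _ d _))// (splitr e).
  by rewrite ltrD// ?(lt_trans _ ne)// metric_sym.
have /card_leEembeds[j ji] := Xmin _ Bb.
have /choice[c cP] (U : B) : exists p : {p : X * nat | D p.2 p.1},
    val U = ball (sval p).1 ((sval p).2.+1%:R^-1 : R).
  by case: U => U /= /set_mem[p Dp UE]; exists (exist _ p Dp).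
have ci : injective c by move=> U V UV; apply: val_inj; rewrite !cP UV.
have Ji : injective (fun s => c (j (SigSub (mem_set (I : [set: L] (pow s)))))).
  by move=> s s' /ci/ji[/powi].
have [k [d di dk]] := konig (fun p => (sval p).2) Ji.
have dD l : D k (sval (d l)).1 by rewrite -(dk l); exact: (svalP (d l)).
have dval l m : (sval (d l)).1 = (sval (d m)).1 -> l = m.
  move=> lm; apply: di; have := dk l; rewrite -(dk m).
  case: (d l) (d m) lm => [[x i] Dx] [[y j'] Dy] /= xy ij.
  by apply: eq_exist; rewrite xy ij.
exists k.+1%:R^-1; first by rewrite invr_gt0.
exists (fun l => (sval (d l)).1) => l m lm.
by apply: dval; exact: (DP k).1 lm.
Qed.

End metric_weight.

(** Basic sets chosen inside small balls around the points [d l] are distinct, which bounds every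
    base from below. All balls of radius [1/(n+1)] form a base of size at most that of [E * nat]. *)
Lemma normed_has_weight (R : realType) (L : Type) (E : normedModType R)
    (d : L -> E) (r : R) : embeds (nat -> L) L -> infinite_set [set: L] ->
  embeds E L -> 0 < r -> (forall l m, `|d l - d m| < r -> l = m) ->
  has_weight E L.
Proof.
move=> Lpow Linf EL r0 dr.
have ge (B : set (set E)) : basis B -> [set: L] #<= B.
  move=> [Bo Bb]; have /choice[b bP] l : exists U : B,
      val U (d l) /\ val U `<=` ball (d l) (r / 2).
    have [|U [BU Ux] Us] := Bb (d l) (ball (d l) (r / 2)).
      by apply: nbhsx_ballx; rewrite divr_gt0.
    by exists (SigSub (mem_set BU)).
  apply/card_leEembeds; exists (b \o val) => -[l l'] [m m'] /= lm.
  apply/val_inj/dr => /=.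
  have [bl _] := bP l; have [_ /(_ (d l))] := bP m.
  rewrite -lm => /(_ bl); rewrite -ball_normE /= distrC => H.
  by rewrite (lt_le_trans H)// ler_pdivrMr// ler_peMr ?ler1n// ltW.
pose B : set (set E) := [set ball p.1 (p.2.+1%:R^-1 : R) | p in [set: E * nat]].
have Bb : basis B.
  split; first by move=> _ [p _ <-]; exact: ball_open.
  move=> x A /nbhs_ballP[e /= e0 xA]; have [n ne] := inv_nat_lt e0.
  exists (ball x (n.+1%:R^-1 : R)).
    by split; [exists (x, n)|apply: ballxx; rewrite invr_gt0].
  by apply: subset_trans xA; apply: le_ball; rewrite ltW.
split=> //; exists B => //; apply/card_eqPle; split; last exact: ge.
apply: (card_le_trans (card_image_le _ _)); apply/card_le_setTP.
by apply: embeds_pair => //; exact: embeds_nat.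
Qed.

(** * The target space *)

Section target_space.
Context {R : realType} (L : Type) (X : metricType R).

Definition gens (i y : X + wtree L) : R :=
  match i, y with
  | inl a, inl x => Num.min 1 (mdist a x)
  | inr v, inr w => (`[< v = w >])%:R
  | _, _ => 0
  end.

Lemma gens_in i : gens i \in cspan_pred gens.
Proof.
apply: cspan_gen_in; exists 1; case: i => [a|v] [x|w] /=; rewrite ?normr0//.
  by rewrite ger0_norm ?ge_min ?lexx// le_min ler01 mdist_ge0.
by case: asboolP => _; rewrite ?normr1 ?normr0.
Qed.

Local Notation E := (cspan gens).

(** Kuratowski's embedding for the metric truncated at 1. The two estimates that follow make it a
    homeomorphism onto its image. *)
Definition dist_vec (x : X) : E := Cspan (gens_in (inl x)).
Definition unit_vec (w : wtree L) : E := Cspan (gens_in (inr w)).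

Lemma dist_vec_lipschitz x y : `|dist_vec x - dist_vec y| <= mdist x y.
Proof.
apply: cspan_le => [|[a|w]]; rewrite ?mdist_ge0// cspanB /=; last first.
  by rewrite subr0 normr0 mdist_ge0.
have := metric_triangle x y a; have := metric_triangle y x a.
rewrite (metric_sym y x) ler_norml => H1 H2; have := mdist_ge0 x y.
by rewrite /Num.min; case: ifPn; case: ifPn; rewrite -?leNgt; lra.
Qed.

Lemma dist_vec_ge x y : Num.min 1 (mdist x y) <= `|dist_vec x - dist_vec y|.
Proof.
apply: le_trans (ler_cspan _ (inl y)); rewrite cspanB /= mdistxx.
by rewrite (_ : Num.min 1 0 = 0) ?subr0 ?ler_norm//; apply/min_idPr.
Qed.

Lemma dist_vec_inj : injective dist_vec.
Proof.
move=> x y xy; have := dist_vec_ge x y; rewrite xy subrr normr0 ge_min ler10/=.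
by move=> xy0; apply: mdist_positivity; apply/eqP; rewrite eq_le xy0 mdist_ge0.
Qed.

Definition tree_of (i : R * (X + wtree L)) : wtree L :=
  if i.2 is inr w then w else Leaf.

Lemma lincomb_inr_neq0 s w : lincomb gens s (inr w) != 0 ->
  exists k, nth Leaf (map tree_of s) k = w.
Proof.
elim: s => [|[c i] s IH]; first by rewrite /lincomb big_nil eqxx.
have [[k <-] _|H] := pselect (exists k, nth Leaf (map tree_of s) k = w).
  by exists k.+1.
rewrite /lincomb big_cons; case: i => [x|v] /=.
  by rewrite mulr0 add0r => /IH.
case: asboolP => [-> _|_]; first by exists 0%N.
by rewrite mulr0 add0r => /IH.
Qed.

(** A coordinate of [p] larger than [1/(n+1)] must occur in the [n]-th approximating combination,
    which involves finitely many trees. The code of [(n, k)] names the [k]-th tree there; [Leaf]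
    fills the gaps. *)
Lemma countable_support (p : E) :
  exists s : nat -> wtree L, forall w, p (inr w) != 0 -> exists n, s n = w.
Proof.
have /choice[s sP] (n : nat) : exists s, forall y,
    `|p y - lincomb gens s y| <= n.+1%:R^-1.
  by apply: cspan_approx; rewrite invr_gt0.
exists (fun m => if unpickle m is Some (n, k) then nth Leaf (map tree_of (s n)) k
                 else Leaf) => w.
rewrite -normr_gt0 => /inv_nat_lt[n nw].
have [|k kw] := @lincomb_inr_neq0 (s n) w.
  apply: contraTneq nw => s0.
  by have := sP n (inr w); rewrite s0 subr0 -leNgt.
by exists (pickle (n, k)); rewrite pickleK.
Qed.

(** A vector is determined by a sequence of finite combinations converging to it. *)
Lemma embeds_target : embeds (nat -> L) L -> infinite_set [set: L] ->
  embeds X L -> embeds E L.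
Proof.
move=> Lpow Linf XL.
apply: (@embeds_trans _ (nat -> seq (R * (X + wtree L)))); last first.
  apply/(embeds_seq_fun Lpow)/(embeds_seq Lpow Linf)/(embeds_pair Lpow).
    exact: embeds_realType.
  by apply: embeds_sum => //; exact: embeds_wtree.
have /choice[s sP] (p : E) : exists s : nat -> seq (R * (X + wtree L)),
    forall n y, `|p y - lincomb gens (s n) y| <= n.+1%:R^-1.
  have H (n : nat) : exists s, forall y, `|p y - lincomb gens s y| <= n.+1%:R^-1.
    by apply: cspan_approx; rewrite invr_gt0.
  by have /choice[t tP] := H; exists t.
exists s => p q pq; apply: cspan_ext => y; apply/eqP; rewrite -subr_eq0 -normr_le0.
apply/ler_addgt0Pl => e e0; rewrite addr0.
have [n ne] := inv_nat_lt (divr_gt0 e0 (ltr0Sn R 1)).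
rewrite -(subrKA (lincomb gens (s p n) y)) (splitr e).
rewrite (le_trans (ler_normD _ _))// lerD//.
  exact: le_trans (sP _ _ _) (ltW ne).
by rewrite distrC pq; exact: le_trans (sP _ _ _) (ltW ne).
Qed.

End target_space.

(** * Continuous bijections onto the target space *)

Section condensation.
Context {R : realType} {L : Type} {X : metricType R}.

Local Notation E := (cspan (@gens R L X)).
Local Notation unit_vec := (@unit_vec R L X).
Local Notation dist_vec := (@dist_vec R L X).

(** * Fresh coordinates and the well-founded relation they induce *)

Variables (code : E * bool -> L) (supp : E -> nat -> wtree L).
Hypothesis code_inj : injective code.
Hypothesis suppP : forall (p : E) w, p (inr w) != 0 -> exists n, supp p n = w.

Implicit Types p q : E.

Definition fresh (p : E) (b : bool) : wtree L := Node (code (p, b)) (supp p).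

Lemma fresh_inj p b q c : fresh p b = fresh q c -> p = q /\ b = c.
Proof. by move=> [/code_inj[-> ->]]. Qed.

Definition precedes (p q : E) := exists b, q (inr (fresh p b)) != 0.

(** If [q] precedes [p], a fresh coordinate of [q] is listed by [supp p], hence is a child of the
    tree [fresh p b]. Induction on trees applies. *)
Lemma precedes_wf : well_founded precedes.
Proof.
suff H w (p : E) b : fresh p b = w -> Acc precedes p by move=> p; exact: (H _ p true).
elim: w p b => [//|l s IH] p b [_ ps]; constructor => q [c /suppP[n]].
by rewrite ps => /esym; exact: IH.
Qed.

Lemma precedes_irr p : ~ precedes p p.
Proof. by elim/(well_founded_ind precedes_wf): p => p IH pp; exact: (IH p pp pp). Qed.

Lemma precedes_asym p q : precedes p q -> ~ precedes q p.
Proof.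
by elim/(well_founded_ind precedes_wf): p q => p IH q pq qp; exact: (IH q qp p).
Qed.

Lemma fresh_eq0 p b : p (inr (fresh p b)) = 0.
Proof.
by apply/eqP; apply: contrapT => /negP pp; apply: (@precedes_irr p); exists b.
Qed.

(** * Hats and bumps on separated balls *)

Variables (rho : R) (d : E -> X).
Hypothesis rho_gt0 : 0 < rho.
Hypothesis d_sep : forall p q, mdist (d p) (d q) < 4 * rho -> p = q.

Definition hat (p : E) (x : X) : R := Num.max 0 (1 - mdist (d p) x / rho).

Lemma hat_gt0 p x : (0 < hat p x) = (mdist (d p) x < rho).
Proof. by rewrite lt_max ltxx/= subr_gt0 ltr_pdivrMr// mul1r. Qed.

Lemma hat_ge0 p x : 0 <= hat p x.
Proof. by rewrite le_max lexx. Qed.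

Lemma hat_le1 p x : hat p x <= 1.
Proof. by rewrite ge_max ler01/= gerBl divr_ge0// ?mdist_ge0// ltW. Qed.

Lemma hat_center p : hat p (d p) = 1.
Proof. by rewrite /hat mdistxx mul0r subr0; apply/max_idPr. Qed.

Lemma hat_dist p x : 0 < hat p x -> mdist (d p) x = rho * (1 - hat p x).
Proof.
move=> /[dup] + /ltW; rewrite hat_gt0 /hat => dx.
have -> : Num.max 0 (1 - mdist (d p) x / rho) = 1 - mdist (d p) x / rho.
  by apply/max_idPr; rewrite subr_ge0 ler_pdivrMr// mul1r ltW.
by move=> _; field; rewrite gt_eqF.
Qed.

Lemma hat_eq1 p x : hat p x = 1 -> x = d p.
Proof.
move=> px; have := @hat_dist p x; rewrite px subrr mulr0 => /(_ ltr01).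
by move=> /mdist_positivity.
Qed.

Lemma hat_eq0 p x : ~ 0 < hat p x -> hat p x = 0.
Proof. by move=> /negP; rewrite -leNgt => h; apply/eqP; rewrite eq_le h hat_ge0. Qed.

(** Two radii [rho] and a gap [2 * rho] add up to the separation [4 * rho]: the balls form a
    discrete family, which later gives continuity. *)
Lemma hat_near p q x y : mdist x y < 2 * rho -> 0 < hat p x -> 0 < hat q y -> p = q.
Proof.
rewrite !hat_gt0 => xy px qy; apply: d_sep.
have := metric_triangle (d p) x (d q); have := metric_triangle x y (d q).
by rewrite (metric_sym y); lra.
Qed.

Lemma hat_uniq p q x : 0 < hat p x -> 0 < hat q x -> p = q.
Proof. by apply: hat_near; rewrite mdistxx mulr_gt0. Qed.

(* On the ball around [d p], as the hat runs from 0 to 1: a kept point is first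
   lifted along two fresh coordinates, then moved to [p] while the lift fades;
   otherwise there is only the lift. The ratio of the two fresh coordinates
   recovers the hat. *)
Definition shift (k : bool) (t : R) : R := if k then Num.max 0 (2 * t - 1) else 0.
Definition lift (k : bool) (t : R) : R := if k then (1 - t) * t else t.

Definition bump k (p : E) t (u : E) : E :=
  u + shift k t *: (p - u) +
  (lift k t *: unit_vec (fresh p true) + (lift k t * t) *: unit_vec (fresh p false)).

Lemma bump0 k p u : bump k p 0 u = u.
Proof.
have s0 : shift k 0 = 0 by case: (k) => //=; apply/max_idPl; lra.
have l0 : lift k 0 = 0 by case: (k); rewrite /= ?mulr0.
by rewrite /bump s0 l0 mul0r !scale0r !addr0.
Qed.

Lemma bump1 p u : bump true p 1 u = p.
Proof.
rewrite /bump /shift /lift/= subrr !mul0r !scale0r !addr0.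
have -> : Num.max 0 (2 * 1 - 1) = 1 :> R by rewrite max_r; lra.
by rewrite scale1r subrKC.
Qed.

Lemma bump_inl k p t u y :
  bump k p t u (inl y) = (1 - shift k t) * u (inl y) + shift k t * p (inl y).
Proof. by rewrite /bump !cspanD !cspanZ cspanB/=; ring. Qed.

(** Both [p] and [dist_vec x] vanish on the fresh coordinates of [p], so only the lift is seen
    there. *)
Lemma bump_fresh k p t x b :
  bump k p t (dist_vec x) (inr (fresh p b)) = lift k t * (if b then 1 else t).
Proof.
have e c : `[< fresh p c = fresh p b >] = (c == b).
  by apply/asboolP/eqP => [/fresh_inj[]|->].
by rewrite /bump !cspanD !cspanZ cspanB/= fresh_eq0 !e; case: (b) => /=; ring.
Qed.

Lemma bump_supp k p t x w : bump k p t (dist_vec x) (inr w) != 0 ->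
  [\/ w = fresh p true, w = fresh p false | p (inr w) != 0].
Proof.
rewrite /bump !cspanD !cspanZ cspanB/=.
case: asboolP => [<-|_]; first by constructor.
case: asboolP => [<-|_]; first by constructor 2.
rewrite !mulr0 !addr0 subr0 add0r => H; constructor 3.
by apply: contraNneq H => ->; rewrite mulr0.
Qed.

Definition bump_on (k : bool) (p : E) (x : X) : E := bump k p (hat p x) (dist_vec x).

(* [y] is kept unless it is a value taken outside of all balls, or a value taken
   off the center on the ball of a preceding point. *)
Definition kept_step (y : E) (kept : forall p, precedes p y -> bool) : bool :=
  `[< (forall x, (forall p, ~ 0 < hat p x) -> y <> dist_vec x) /\
      (forall p (py : precedes p y) x, 0 < hat p x -> y = bump_on (kept p py) p x ->
         kept p py /\ x = d p) >].

Definition kept : E -> bool := Fix precedes_wf _ kept_step.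

Lemma keptP y : reflect
  ((forall x, (forall p, ~ 0 < hat p x) -> y <> dist_vec x) /\
   (forall p x, precedes p y -> 0 < hat p x -> y = bump_on (kept p) p x ->
      kept p /\ x = d p)) (kept y).
Proof.
have -> : kept y = @kept_step y (fun p _ => kept p).
  rewrite /kept Fix_eq// => z k k' kk'; have -> // : k = k'.
  apply: functional_extensionality_dep => p.
  by apply: functional_extensionality_dep => pz; exact: kk'.
apply: (iffP (asboolP _)) => -[H1 H2]; split=> // p.
  by move=> x py; exact: H2.
by move=> py x; exact: H2.
Qed.

Definition condense (x : X) : E :=
  if pselect (exists p, 0 < hat p x) is left e
  then bump_on (kept (projT1 (cid e))) (projT1 (cid e)) x else dist_vec x.

Lemma condense_in p x : 0 < hat p x -> condense x = bump_on (kept p) p x.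
Proof.
rewrite /condense => px; case: pselect => [e|[]]; last by exists p.
by case: (cid e) => /= q qx; rewrite (hat_uniq qx px).
Qed.

Lemma condense_out x : (forall p, ~ 0 < hat p x) -> condense x = dist_vec x.
Proof. by rewrite /condense => H; case: pselect => // -[p px]; case: (H p). Qed.

Lemma condense_center p : kept p -> condense (d p) = p.
Proof.
by move=> kp; rewrite (@condense_in p) ?hat_center// /bump_on kp hat_center bump1.
Qed.

Lemma lift_neq0 p x : 0 < hat p x -> ~ (kept p /\ x = d p) ->
  lift (kept p) (hat p x) != 0.
Proof.
rewrite /lift => px H; case: ifPn => kp; last by rewrite gt_eqF.
rewrite mulf_neq0 ?gt_eqF// subr_gt0 lt_neqAle hat_le1 andbT.
by apply/eqP => /hat_eq1 xp; exact: H.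
Qed.

Lemma bump_on_fresh_neq0 p x : 0 < hat p x -> ~ (kept p /\ x = d p) ->
  forall b, bump_on (kept p) p x (inr (fresh p b)) != 0.
Proof.
move=> px H b; rewrite /bump_on bump_fresh mulf_neq0 ?lift_neq0//.
by case: b; rewrite ?oner_neq0// gt_eqF.
Qed.

(** The ratio of the fresh coordinates gives the hat. Off a kept center the shift is below 1, so the
    metric coordinates then give back [dist_vec x]. *)
Lemma bump_on_inj p x y : 0 < hat p x -> 0 < hat p y ->
  ~ (kept p /\ x = d p) -> bump_on (kept p) p x = bump_on (kept p) p y -> x = y.
Proof.
move=> px py Hx xy.
have Hy : ~ (kept p /\ y = d p).
  move=> [kp yp]; have := bump_on_fresh_neq0 px Hx true.
  by rewrite xy /bump_on yp kp hat_center bump1 fresh_eq0 eqxx.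
have E1 := congr1 (fun f : E => f (inr (fresh p true))) xy.
have E2 := congr1 (fun f : E => f (inr (fresh p false))) xy.
rewrite /bump_on !bump_fresh !mulr1 in E1 E2.
have txy : hat p x = hat p y.
  by move: E2; rewrite E1; apply: mulfI; exact: lift_neq0.
apply: (@dist_vec_inj R L X); apply: cspan_ext => -[a|//].
have := congr1 (fun f : E => f (inl a)) xy.
rewrite /bump_on !bump_inl txy => /addIr; apply: mulfI.
rewrite subr_eq0 /shift; case: ifPn => [kp|_]; last by rewrite oner_neq0.
have ty : hat p y < 1.
  rewrite lt_neqAle hat_le1 andbT; apply/eqP => /hat_eq1 yp; exact: Hy.
by rewrite gt_eqF// gt_max ltr01; lra.
Qed.

(** Off kept centers, a value on the ball of [p] is nonzero on the fresh coordinates of [p], whereas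
    values outside the balls have no tree coordinates. If such values on the balls of [p] and [q]
    agree and [p] differs from [q], each of the two precedes the other. Kept centers are handled by
    the condition defining [kept]. *)
Lemma condense_inj : injective condense.
Proof.
have out_in p x y : 0 < hat p x -> (forall q, ~ 0 < hat q y) ->
    condense x <> condense y.
  move=> px yout xy; have [[kp xp]|H] := pselect (kept p /\ x = d p).
    have /keptP[/(_ y yout) + _] := kp.
    by rewrite -(condense_center kp) -xp xy condense_out.
  have := bump_on_fresh_neq0 px H true.
  by rewrite -(condense_in px) xy condense_out// eqxx.
move=> x y xy.
have [[p px]|xout] := pselect (exists p, 0 < hat p x); last first.
  have {}xout p : ~ 0 < hat p x by move=> px; apply: xout; exists p.
  have [[q qy]|yout] := pselect (exists p, 0 < hat p y).
    by case: (out_in q y x qy xout).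
  have {}yout p : ~ 0 < hat p y by move=> py; apply: yout; exists p.
  by apply: (@dist_vec_inj R L X); rewrite -(condense_out xout) -(condense_out yout).
have [[q qy]|yout] := pselect (exists p, 0 < hat p y); last first.
  have {}yout q : ~ 0 < hat q y by move=> py; apply: yout; exists q.
  by case: (out_in p x y px yout).
(* A kept center can share its value only with a kept center: otherwise [q'] precedes [p'], and
   [kept p'] excludes this value on the ball of [q']. *)
have center_center p' q' x' y' : 0 < hat q' y' -> condense x' = condense y' ->
    kept p' -> x' = d p' -> kept q' /\ y' = d q'.
  move=> qy' xy' kp xp; have E1 := condense_center kp.
  apply: contrapT => H; have pq : precedes q' p'.
    exists true; rewrite -E1 -xp xy' (condense_in qy').
    exact: bump_on_fresh_neq0.
  have /keptP[_ kpP] := kp; apply: H; apply: (kpP _ _ pq qy').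
  by rewrite -E1 -xp xy' (condense_in qy').
have [[kp xp]|Hx] := pselect (kept p /\ x = d p).
  have [kq yq] := center_center p q x y qy xy kp xp.
  by rewrite xp yq; congr d; rewrite -(condense_center kp) -(condense_center kq) -xp -yq.
have Hy : ~ (kept q /\ y = d q).
  by move=> [kq yq]; exact/Hx/(center_center q p y x px (esym xy) kq yq).
suff pq : p = q.
  by subst q; apply: (bump_on_inj px qy Hx); rewrite -!condense_in//.
have := bump_on_fresh_neq0 px Hx true.
rewrite -(condense_in px) xy (condense_in qy) => /bump_supp[/fresh_inj[]//|/fresh_inj[]//|qp].
have := bump_on_fresh_neq0 qy Hy true.
rewrite -(condense_in qy) -xy (condense_in px) => /bump_supp[/fresh_inj[]//|/fresh_inj[]//|pq].
by case: (@precedes_asym p q); [exists true|exists true].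
Qed.

(** A kept [y] is the value at its center; a [y] that is not kept was rejected precisely because it
    is a value elsewhere. *)
Lemma condense_surj y : exists x, condense x = y.
Proof.
have [ky|/keptP nk] := boolP (kept y).
  by exists (d y); exact: condense_center.
apply: contrapT => H; apply: nk; split=> [x xout yx|p x py px yx].
  by apply: H; exists x; rewrite condense_out.
by case: H; exists x; rewrite (condense_in px).
Qed.

(** * Continuity of the bijection *)

Lemma hat_lipschitz p x y : `|hat p x - hat p y| <= mdist x y / rho.
Proof.
have H : `|mdist (d p) x / rho - mdist (d p) y / rho| <= mdist x y / rho.
  rewrite -mulrBl normrM (gtr0_norm (_ : 0 < rho^-1)) ?invr_gt0//.
  rewrite ler_pM2r ?invr_gt0// ler_norml.
  have := metric_triangle (d p) x y; have := metric_triangle (d p) y x.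
  by rewrite (metric_sym y x); lra.
apply: le_trans H; rewrite /hat /Num.max; move: (_ / _) (_ / _) => s t.
by rewrite ler_norml; have := ler_norm (t - s); have := ler_norm (s - t);
   rewrite (distrC s); case: ifPn; case: ifPn; rewrite -?leNgt; lra.
Qed.

Lemma continuous_lipschitz (V : normedModType R) (f : X -> V) c : 0 < c ->
  (forall x y, `|f x - f y| <= mdist x y / c) -> continuous f.
Proof.
move=> c0 fc x; apply/cvgrPdist_lt => e e0; apply/nbhs_ballP.
exists (e * c); first by rewrite /= mulr_gt0.
move=> y; rewrite ballEmdist /= => xy; apply: le_lt_trans (fc x y) _.
by rewrite ltr_pdivrMr.
Qed.

Lemma bump_on_continuous k p : continuous (bump_on k p).
Proof.
have hc : continuous (hat p) by apply: (continuous_lipschitz rho_gt0); exact: hat_lipschitz.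
have dc : continuous dist_vec.
  apply: (continuous_lipschitz ltr01) => x y; rewrite divr1.
  exact: dist_vec_lipschitz.
have sc : continuous (shift k \o hat p : X -> R).
  move=> x; rewrite /shift /comp; case: (k) => /=; last exact: cvg_cst.
  apply: (@continuous_max _ X (fun=> 0) (fun x => 2 * hat p x - 1)).
    exact: cvg_cst.
  by apply: cvgB; [apply: cvgMr; exact: hc|exact: cvg_cst].
have lc : continuous (lift k \o hat p : X -> R).
  move=> x; rewrite /lift /comp; case: (k) => /=; last exact: hc.
  by apply: cvgM; [apply: cvgB; [exact: cvg_cst|exact: hc]|exact: hc].
move=> x; apply: cvgD; first apply: cvgD; first exact: dc.
  by apply: cvgZ; [exact: sc|apply: cvgB; [exact: cvg_cst|exact: dc]].
apply: cvgD; apply: cvgZ; [exact: lc|exact: cvg_cst| |exact: cvg_cst].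
by apply: cvgM; [exact: lc|exact: hc].
Qed.

(** The [rho]-ball around [x] meets the ball of at most one [p], and [bump_on] reduces to [dist_vec]
    where the hat of [p] vanishes. *)
Lemma condense_near x : exists p, forall y, mdist x y < rho ->
  condense y = bump_on (kept p) p y.
Proof.
have [p pP] : exists p, forall q y, mdist x y < rho -> 0 < hat q y -> q = p.
  have [[q [y [xy qy]]]|H] := pselect (exists q y, mdist x y < rho /\ 0 < hat q y).
    exists q => q' y' xy' qy'; apply: hat_near qy' qy.
    have := metric_triangle y' x y; rewrite (metric_sym y' x); lra.
  (* No ball is met near [x]; the choice of [0] is arbitrary. *)
  by exists 0 => q y xy qy; case: H; exists q, y.
exists p => y xy; have [py|/hat_eq0 py] := pselect (0 < hat p y).
  exact: condense_in.
rewrite /bump_on py bump0 condense_out// => q qy.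
by have := qy; rewrite (pP q y xy qy) py ltxx.
Qed.

Lemma condense_continuous : continuous condense.
Proof.
move=> x; have [p pP] := condense_near x.
have px : condense x = bump_on (kept p) p x by apply: pP; rewrite mdistxx.
rewrite /continuous_at px; apply: cvg_trans (@bump_on_continuous (kept p) p x).
apply: near_eq_cvg; apply/nbhs_ballP; exists rho => // y.
by rewrite ballEmdist /= => /pP.
Qed.

End condensation.

(** * The two topologies *)

Section joint_embedding.
Context {R : realType} {L : Type} {X : metricType R}.

Local Notation E := (cspan (@gens R L X)).
Local Notation dist_vec := (@dist_vec R L X).

Variables (code : E * bool -> L) (supp : E -> nat -> wtree L).
Hypothesis code_inj : injective code.
Hypothesis suppP : forall (p : E) w, p (inr w) != 0 -> exists n, supp p n = w.
Variables (rho : R) (d1 d2 : E -> X).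
Hypothesis rho_gt0 : 0 < rho.
Hypothesis d1_sep : forall p q, mdist (d1 p) (d1 q) < 4 * rho -> p = q.
Hypothesis d2_sep : forall p q, mdist (d2 p) (d2 q) < 4 * rho -> p = q.
Hypothesis d12_sep : forall p q, 4 * rho <= mdist (d1 p) (d2 q).

Let f1 : X -> E := condense code suppP rho d1.
Let f2 : X -> E := condense code suppP rho d2.

Lemma hat_disjoint p q x : 0 < hat rho d1 p x -> ~ 0 < hat rho d2 q x.
Proof.
rewrite !hat_gt0// => px qx; have := d12_sep p q; apply/negP; rewrite -ltNge.
by have := metric_triangle (d1 p) x (d2 q); have := rho_gt0; rewrite (metric_sym x); lra.
Qed.

(** The map [f1] is injective and equals [dist_vec] at the centers [d2 q], none of which is [x].
    Their images are [2 * s] apart, so at most one lies within [s] of [f1 x]. *)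
Lemma center2_away x : (forall q, ~ 0 < hat rho d2 q x) ->
  exists2 h, 0 < h & forall q, h <= `|dist_vec (d2 q) - f1 x|.
Proof.
move=> xout; pose s : R := Num.min 1 (4 * rho) / 2.
have s0 : 0 < s by rewrite divr_gt0// lt_min ltr01 mulr_gt0.
have f1d2 q : f1 (d2 q) = dist_vec (d2 q).
  apply: condense_out => p pq; apply: (hat_disjoint pq (q := q)).
  by rewrite hat_center ltr01.
have [[q qs]|H] := pselect (exists q, `|dist_vec (d2 q) - f1 x| < s); last first.
  by exists s => // q; rewrite leNgt; apply/negP => qs; apply: H; exists q.
exists `|dist_vec (d2 q) - f1 x|.
  rewrite normr_gt0 subr_eq0 -f1d2; apply/eqP => /(condense_inj code_inj rho_gt0 d1_sep) qx.
  by apply: (xout q); rewrite -qx hat_center.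
move=> q'; have [->//|qq'] := pselect (q' = q).
rewrite (le_trans (ltW qs))// leNgt; apply/negP => q's.
apply: qq'; apply: d2_sep; have := dist_vec_ge L (d2 q') (d2 q).
have : `|dist_vec (d2 q') - dist_vec (d2 q)| < s + s.
  rewrite -(subrKA (f1 x)) (le_lt_trans (ler_normD _ _))// ltrD//.
  by rewrite distrC.
rewrite -splitr => H1 H2; have := le_lt_trans H2 H1.
by rewrite lt_min !gt_min ltxx/= => /andP[m1 /orP[r1|//]]; exact: lt_trans r1.
Qed.

(** Where [f2] is undeformed at [x], the only points [y] whose distance [f2] may fail to detect are
    those near a pushed center [d2 q]; these are excluded by [f1], which keeps such centers away
    from [f1 x]. *)
Lemma joint_embedding_out2 x e : (forall q, ~ 0 < hat rho d2 q x) -> 0 < e ->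
  exists2 delta, 0 < delta & forall y,
    `|f1 x - f1 y| < delta -> `|f2 x - f2 y| < delta -> mdist x y < e.
Proof.
move=> xout e0; have [h h0 hP] := center2_away xout.
have f2x : f2 x = dist_vec x by exact: condense_out.
(* The bound [1 / 4] stays below the truncation level 1; the last term makes
   [2 * rho * delta + delta] at most [h]. *)
exists (Num.min (Num.min e (1 / 4)) (h / (1 + 2 * rho))).
  by rewrite !lt_min e0 !divr_gt0//= addr_gt0// mulr_gt0.
move=> y; rewrite !lt_min => /andP[_ y1] /andP[/andP[ye y4] yh].
have fin (z : R) : Num.min 1 (mdist y x) <= z -> z < e -> z < 1 / 4 -> mdist x y < e.
  by rewrite metric_sym ge_min => /orP[|]; lra.
have [[q qy]|yout] := pselect (exists q, 0 < hat rho d2 q y); last first.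
  have yP : f2 y = dist_vec y by apply: condense_out => q qy; apply: yout; exists q.
  by apply: fin ye y4; rewrite f2x yP distrC; exact: dist_vec_ge.
have f2y := condense_in code suppP rho_gt0 d2_sep qy; rewrite -/(f2 y) in f2y.
have f1y : f1 y = dist_vec y by apply: condense_out => p py; exact: hat_disjoint py qy.
set k := kept _ _ _ _ _ in f2y; set t := hat _ _ _ _ in qy.
(* Without shift, [f2 y] has the metric coordinates of [dist_vec y], and [inl x] reads off the
   truncated distance. *)
have [s0|s0] := eqVneq (shift k t) 0.
  apply: fin ye y4; apply: le_trans (ler_cspan _ (inl x)).
  rewrite cspanB distrC f2y /bump_on -/t bump_inl s0 subr0 mul1r mul0r addr0 f2x /=.
  by rewrite mdistxx (@min_r _ _ 1 0)// subr0 ler_norm.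
(* A nonzero shift means [t > 1/2], so a small lift [(1 - t) * t] makes [1 - t] small: [y] is close
   to [d2 q], and [f1 x] too close to [dist_vec (d2 q)]. *)
exfalso; have [kT t2] : k /\ 1 / 2 < t.
  move: s0; rewrite /shift; case: (k); rewrite ?eqxx// => s0; split => //.
  rewrite ltNge; apply: contra s0 => t2; apply/eqP.
  by rewrite max_l//; lra.
have : `|lift k t| <= `|f2 x - f2 y|.
  apply: le_trans (ler_cspan _ (inr (fresh code supp q true))).
  by rewrite cspanB distrC f2y /bump_on -/t bump_fresh// f2x /= subr0 mulr1.
have t1 : t <= 1 by exact: hat_le1.
rewrite /lift kT ger0_norm; last by rewrite mulr_ge0//; lra.
move=> /le_lt_trans/(_ yh) lf.
have := hP q; apply/negP; rewrite -ltNge.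
have : `|dist_vec (d2 q) - f1 x| <= rho * (1 - t) + `|f1 x - f1 y|.
  rewrite -(subrKA (dist_vec y)) (le_trans (ler_normD _ _))// lerD//.
    by rewrite -hat_dist//; exact: dist_vec_lipschitz.
  by rewrite f1y distrC.
move=> /le_lt_trans; apply.
set D := h / (1 + 2 * rho) in lf y1.
have -> : h = rho * (2 * D) + D.
  by rewrite /D; field; rewrite gt_eqF// addr_gt0// mulr_gt0.
rewrite ler_ltD// ler_pM2l//; apply: ltW; move: lf t2 t1; nra.
Qed.

End joint_embedding.

(** * Topologies transported along bijections, and their supremum *)

Lemma homeomorphic_initial (S : choiceType) (T : topologicalType) (f : S -> T) :
  bijective f -> homeomorphic (initial_topology f) T.
Proof.
move=> [g fK gK]; exists f, g; split => //; first exact: initial_continuous.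
apply/continuousP => _ [B oB <-].
by rewrite -comp_preimage (_ : f \o g = id)//; apply/funext => y /=.
Qed.

(** By the estimate, every open set of [X] contains, around each of its points, an intersection of
    preimages of balls under [f1] and [f2], which is open in any topology finer than both. *)
Lemma is_supremum_initial (R : realType) (X : metricType R)
    (E1 E2 : normedModType R) (f1 : X -> E1) (f2 : X -> E2) :
  continuous f1 -> continuous f2 ->
  (forall x e, 0 < e -> exists2 delta, 0 < delta & forall y,
    `|f1 x - f1 y| < delta -> `|f2 x - f2 y| < delta -> mdist x y < e) ->
  is_supremum (Topological.class X) (Topological.class (initial_topology f1))
    (Topological.class (initial_topology f2)).
Proof.
move=> c1 c2 f12; split.
- by move=> _ [B oB <-]; move/continuousP: c1; exact.
- by move=> _ [B oB <-]; move/continuousP: c2; exact.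
have sub (A : set X) (x : X) : open A -> A x -> exists2 delta, 0 < delta &
    f1 @^-1` ball (f1 x) delta `&` f2 @^-1` ball (f2 x) delta `<=` A.
  move=> oA Ax; have /nbhs_ballP[e /= e0 eA] : nbhs x A by apply: open_nbhs_nbhs.
  have [delta d0 dP] := f12 x e e0; exists delta => // y [/= y1 y2].
  apply: eA; rewrite ballEmdist /=.
  by move: y1 y2; rewrite -!ball_normE /=; exact: dP.
move=> s s1 s2 A oA; rewrite /opens_of openE => x Ax.
have [delta d0 dA] := sub A x oA Ax.
rewrite /interior nbhsE; eexists; last exact: dA.
split; last by split; exact: ballxx.
apply: openI; [apply: s1|apply: s2].
  by exists (ball (f1 x) delta) => //; exact: ball_open.
by exists (ball (f2 x) delta) => //; exact: ball_open.
Qed.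

Local Close Scope ring_scope.

Theorem theorem1p1 (R : realType) (L : Type)
    (Linf : infinite_set [set: L]) (Lpow : [set: L] #= [set: nat -> L])
    (X : metricType R) (wX : has_weight X L) :
  exists t1 t2 : Topological X,
    [/\ is_supremum (Topological.class X) t1 t2,
        (exists E1 : completeNormedModType R,
           has_weight E1 L /\ homeomorphic (Topological.Pack t1) E1)
      & (exists E2 : completeNormedModType R,
           has_weight E2 L /\ homeomorphic (Topological.Pack t2) E2)].
Proof.
have {}Lpow : embeds (nat -> L) L.
  by move/card_eqPle: Lpow => [_ /card_le_setTP].
have [r r0 [s s_sep]] := separated_embedding Lpow wX.
pose E := cspan (@gens R L X).
have EL : embeds E L by apply: embeds_target => //; exact: metric_embeds.
have wE : has_weight E L.
  apply: (@normed_has_weight R L E (fun l => dist_vec L (s l)) (Num.min 1 r)%R) => //.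
    by rewrite lt_min ltr01.
  move=> l m /(le_lt_trans (dist_vec_ge L _ _)).
  rewrite lt_min !gt_min ltxx/= => /andP[m1 /orP[r1|/s_sep//]].
  by apply: s_sep; exact: lt_trans r1.
have [code code_inj] : embeds (E * bool) L.
  by apply: embeds_pair => //; exact: embeds_bool.
have /choice[supp suppP] := @countable_support R L X.
pose rho := (r / 4)%R; have rho0 : (0 < rho)%R by rewrite divr_gt0.
(* The boolean tag splits one separated family into two halves, each indexed by all of [E]. *)
pose d b p := s (code (p, b)).
have rhoE : (4 * rho = r)%R by rewrite /rho; field.
have d_sep b p q : (mdist (d b p) (d b q) < 4 * rho)%R -> p = q.
  by rewrite rhoE => /s_sep/code_inj[].
have d_sep2 b p q : (4 * rho <= mdist (d b p) (d (~~ b) q))%R.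
  rewrite rhoE leNgt; apply/negP => /s_sep/code_inj[_].
  by case: b.
pose f b := condense code suppP rho (d b).
have f_bij b : bijective (f b).
  have /choice[g fK] := condense_surj code suppP rho0 (d_sep b).
  exists g => // x.
  by apply: (condense_inj code_inj (suppP := suppP) rho0 (d_sep b)); exact: fK.
exists (Topological.class (initial_topology (f true))),
  (Topological.class (initial_topology (f false))); split.
- apply: is_supremum_initial.
  + exact: condense_continuous (d_sep _).
  + exact: condense_continuous (d_sep _).
  + move=> x e e0.
    (* Balls of the two halves are disjoint, so [x] avoids one half entirely; in the second case the
       roles of the two maps are exchanged. *)
    have [x2|/existsNP[q /contrapT qx]] :=
      pselect (forall q, ~ (0 < hat rho (d false) q x)%R).
      exact: (joint_embedding_out2 code_inj suppP rho0
        (d_sep true) (d_sep false) (d_sep2 true)).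
    have x1 p : ~ (0 < hat rho (d true) p x)%R.
      by move=> px; exact: (hat_disjoint rho0 (d_sep2 true) px qx).
    have [delta d0 dP] := joint_embedding_out2 code_inj suppP rho0
      (d_sep false) (d_sep true) (d_sep2 false) x1 e0.
    by exists delta => // y y1 y2; apply: dP.
- by exists (E : completeNormedModType R); split => //; exact: homeomorphic_initial.
- by exists (E : completeNormedModType R); split => //; exact: homeomorphic_initial.
Qed.
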